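(* Suppose that the data are forward-Lipschitz and backward-regular (terms defined in the context). Let $\hat L\in\mathcal V$, let $\hat X$ be the solution of the forward equation with input $\hat L$ and $(\hat Y,\hat Z,\hat A)$ the solution of the reflected BSDE with input $\hat L$, and put $\hat\xi_t:=h(t,\hat X_t,\mathbb E[\int_{0^-}^T\phi(t-s)d\hat L_s])$. Define, with $\inf\emptyset=T$, $$\tau_{\min}=\inf\{t\in[0,T]:\hat Y_t=\hat\xi_t\},\qquad\tau_{\max}=\inf\{t\in[0,T]:\hat A_t>0\},$$ and $L^{\min}_t=\mathbf 1_{t<\tau_{\min}}$, $L^{\max}_t=\mathbf 1_{t<\tau_{\max}}$ for $0\le t\le T$. Let $L\in\mathcal V$ satisfy $$\int_{0^-}^T(\hat Y_t-\hat\xi_t)\,dL_t=0\qquad\text{and}\qquad\int_{0^-}^T\hat A_t\,dL_t=0\quad\text{a.s.}$$ Then, $\mathbb P$-a.s., $$L^{\min}_t\le L_t\le L^{\max}_t,\qquad0\le t\le T,$$ or, equivalently, almost surely, $L_t=1$ for $t<\tau_{\min}$ and $L_t=0$ for $t\ge\tau_{\max}$.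
   Context: Fix $T>0$, integers $d,k,m\ge1$ and a real $q\ge4$. $(\Omega,\mathcal F,\mathbb P)$ is a complete probability space carrying a standard $m$-dimensional Brownian motion $W$ and a random variable $X_0:\Omega\to\mathbb R^d$ independent of $W$ with $\mathbb E[|X_0|^q]<\infty$; $\{\mathcal F_t\}_{t\in[0,T]}$ is the filtration generated by $X_0$ and $W$, augmented with all $\mathbb P$-null sets. Spaces (of equivalence classes; vector dimension clear from use): $\mathbb S^2$ = adapted continuous processes with $\mathbb E[\sup_{t}|Y_t|^2]<\infty$; $\mathbb H^2$ = progressively measurable processes with $\mathbb E[\int_0^T|Z_t|^2dt]<\infty$; $\mathbb A^2$ = real-valued non-decreasing processes $A\in\mathbb S^2$ with $A_0=0$; $\mathcal V\subset\mathbb H^2(\mathbb R)$ = classes admitting a representative $L$ that is $[0,1]$-valued, adapted, non-increasing, càdlàg with $L_T=0$. We set $L_{0^-}:=1$ and always use this representative. Integrals $\int_{0^-}^T\cdot\,dL_t$ include the jump $L_0-1$ at time $0$ (integrands take at $0^-$ their value at $0$). Data: measurable functions $b:[0,T]\times\mathbb R^d\times\mathbb R^k\to\mathbb R^d$, $\bar b:[0,T]\times\mathbb R^d\to\mathbb R^k$, $\sigma:[0,T]\times\mathbb R^d\times\mathbb R^k\to\mathbb R^{d\times m}$, $\bar\sigma:[0,T]\times\mathbb R^d\to\mathbb R^k$, $f:[0,T]\times\mathbb R^d\times\mathbb R^k\to\mathbb R$, $\bar f:[0,T]\times\mathbb R^d\to\mathbb R^k$, $h:[0,T]\times\mathbb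 R^d\times\mathbb R\to\mathbb R$, $\phi:[-T,T]\to\mathbb R$. The data are: - forward-Lipschitz if for some $K\ge0$: $|b(t,x,m)-b(t,x',m')|+|\sigma(t,x,m)-\sigma(t,x',m')|\le K(|x-x'|+|m-m'|)$, $|\bar b(t,x)-\bar b(t,x')|+|\bar\sigma(t,x)-\bar\sigma(t,x')|\le K|x-x'|$, $|b(t,0,0)|+|\sigma(t,0,0)|+|\bar b(t,0)|+|\bar\sigma(t,0)|\le K$ for all arguments; - backward-regular if for some $K\ge0$, $r\in[1,q/2)$: $|f(t,x,m')-f(t,x,m)|\le K|m'-m|$, $|f(t,x,0)|+|h(t,x,0)|+|\bar f(t,x)|\le K(1+|x|^r)$, $|h(t,x,w)-h(t,x,w')|\le K|w-w'|$ for all arguments, $h$ is jointly continuous and $\phi\in\mathcal C^1([-T,T])$. Forward equation with input $L\in\mathcal V$: $X_t=X_0+\int_0^tb(s,X_s,\mathbb E[\bar b(s,X_s)L_s])ds+\int_0^t\sigma(s,X_s,\mathbb E[\bar\sigma(s,X_s)L_s])dW_s$, $t\in[0,T]$. Reflected BSDE with input $L$: with $X$ the solution of the forward equation with input $L$ and $\xi_t:=h(t,X_t,\mathbb E[\int_{0^-}^T\phi(t-s)dL_s])$, find $(Y,Z,A)\in\mathbb S^2\times\mathbb H^2\times\mathbb A^2$ with $$Y_t=\xi_T+\int_t^Tf(s,X_s,\mathbb E[\bar f(s,X_s)L_s])ds+A_T-A_t-\int_t^T(Z_s,dW_s),\quad Y_t\ge\xi_t,\ 0\le t\le T,\quad\int_0^T(Y_t-\xi_t)dA_t=0.$$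 For forward-Lipschitz, backward-regular data both problems have a unique solution for every $L\in\mathcal V$. *)

(* Defs.v *)
From HB Require Import structures.
From mathcomp Require Import all_boot all_order all_algebra.
From mathcomp Require Import all_classical all_reals all_analysis.

Set Implicit Arguments.
Unset Strict Implicit.
Unset Printing Implicit Defensive.

Import Order.TTheory GRing.Theory Num.Theory.
Import numFieldNormedType.Exports.

Local Open Scope classical_set_scope.
Local Open Scope ring_scope.

(* Euclidean norm (Frobenius norm for matrices); the library norm on matrices
   is the maximum norm. *)
Definition enorm (R : realType) (a b : nat) (x : 'M[R]_(a, b)) : R :=
  Num.sqrt (\sum_i \sum_j x i j ^+ 2).

Definition borel (U : topologicalType) : set (set U) := <<s @open U >>.

(* Measurability of the restriction of [g] to [D], for a sigma-algebra [G]. *)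
Definition measurable_wrt (S : Type) (U : topologicalType)
    (G : set (set S)) (D : set S) (g : S -> U) : Prop :=
  forall B, borel B -> G (D `&` g @^-1` B).

Definition independent (disp : measure_display) (Om : measurableType disp)
    (R : realType) (P : probability Om R) (G H : set (set Om)) : Prop :=
  forall A B, G A -> H B -> P (A `&` B) = (P A * P B)%E.

(* inf with the convention that the infimum of the empty set is [T]; the
   library's [inf set0] is 0. *)
Definition inf_or (R : realType) (T : R) (S : set R) : R :=
  if `[< S !=set0 >] then inf S else T.

Section Stieltjes.
Context (R : realType).

Definition is_cumulative (F : R -> R) : Prop :=
  {homo F : x y / x <= y} /\ right_continuous F.

Definition pack_cumulative (F : R -> R) (HF : is_cumulative F) :
    cumulative R R :=
  HB.pack F (isCumulative.Build R _ R F HF.1 HF.2).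

Lemma is_cumulative_cst : is_cumulative (cst (0 : R)).
Proof. by split=> [//|x]; exact: cvg_cst. Qed.

(* [F] itself when it is nondecreasing and right-continuous; the zero function
   (hence the zero measure) otherwise. *)
Definition as_cumulative (F : R -> R) : cumulative R R :=
  match pselect (is_cumulative F) with
  | left HF => pack_cumulative HF
  | right _ => pack_cumulative is_cumulative_cst
  end.

(* A path [g] on [0, T], extended by [g T] after [T] and by the value [v]
   of [g] at 0- before 0. *)
Definition ext_path (T v : R) (g : R -> R) (t : R) : R :=
  if t < 0 then v else g (Num.min t T).

(* Lebesgue-Stieltjes integral of [F] with respect to a nondecreasing
   right-continuous path [g] over [0, T], including the jump [g 0 - v] at 0. *)
Definition incr_int (T v : R) (g F : R -> R) : \bar R :=
  (\int[lebesgue_stieltjes_measure (as_cumulative (ext_path T v g))]_(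
     t in `[0%R, T]) (F t)%:E)%E.

(* Integral over [0-, T] with respect to a nonincreasing right-continuous path
   [l] with the convention that [l] equals 1 at 0-. *)
Definition decr_int (T : R) (F l : R -> R) : \bar R :=
  (- incr_int T (- 1)%R (fun t => - l t)%R F)%E.

End Stieltjes.

(* The coefficients; time arguments are only relevant in [0, T], and those of
   [phi] in [-T, T]. *)
Record data (R : realType) (d k m : nat) := Data {
  coef_b : R -> 'cV[R]_d -> 'cV[R]_k -> 'cV[R]_d;
  coef_bbar : R -> 'cV[R]_d -> 'cV[R]_k;
  coef_sigma : R -> 'cV[R]_d -> 'cV[R]_k -> 'M[R]_(d, m);
  coef_sigmabar : R -> 'cV[R]_d -> 'cV[R]_k;
  coef_f : R -> 'cV[R]_d -> 'cV[R]_k -> R;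
  coef_fbar : R -> 'cV[R]_d -> 'cV[R]_k;
  coef_h : R -> 'cV[R]_d -> R -> R;
  coef_phi : R -> R
}.

Section DataConditions.
Context (R : realType) (d k m : nat) (T q : R) (D : data R d k m).

Definition borel_fun (U V : topologicalType) (A : set U) (g : U -> V) : Prop :=
  measurable_wrt (@borel U) A g.

Definition strip2 : set (R * 'cV[R]_d)%type := [set z | 0 <= z.1 <= T].

Definition strip3 (V : topologicalType) : set (R * 'cV[R]_d * V)%type :=
  [set z | 0 <= z.1.1 <= T].

Definition data_measurable : Prop :=
  [/\ borel_fun (@strip3 'cV[R]_k) (fun z => coef_b D z.1.1 z.1.2 z.2),
      borel_fun strip2 (fun z => coef_bbar D z.1 z.2),
      borel_fun (@strip3 'cV[R]_k) (fun z => coef_sigma D z.1.1 z.1.2 z.2) &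
      borel_fun strip2 (fun z => coef_sigmabar D z.1 z.2)] /\
  [/\ borel_fun (@strip3 'cV[R]_k) (fun z => coef_f D z.1.1 z.1.2 z.2 : R),
      borel_fun strip2 (fun z => coef_fbar D z.1 z.2),
      borel_fun (@strip3 R) (fun z => coef_h D z.1.1 z.1.2 z.2 : R) &
      borel_fun [set t : R | - T <= t <= T] (coef_phi D)].

Definition forward_lipschitz : Prop :=
  exists K : R, 0 <= K /\ forall t : R, 0 <= t <= T ->
    [/\ forall x x' y y',
          enorm (coef_b D t x y - coef_b D t x' y')
            + enorm (coef_sigma D t x y - coef_sigma D t x' y')
          <= K * (enorm (x - x') + enorm (y - y')),
        forall x x',
          enorm (coef_bbar D t x - coef_bbar D t x')
            + enorm (coef_sigmabar D t x - coef_sigmabar D t x')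
          <= K * enorm (x - x') &
        enorm (coef_b D t 0 0) + enorm (coef_sigma D t 0 0)
          + enorm (coef_bbar D t 0) + enorm (coef_sigmabar D t 0) <= K].

(* C^1 on a closed interval, with one-sided derivatives at the endpoints. *)
Definition C1_on (A : set R) (g : R -> R) : Prop :=
  exists g' : R -> R, {within A, continuous g'} /\
    forall t : R, A t ->
      (s - t)^-1 * (g s - g t) @[s --> within A t^'] --> g' t.

Definition backward_regular : Prop :=
  (exists K r : R, [/\ 0 <= K, 1 <= r, r < q / 2 &
    forall t : R, 0 <= t <= T ->
    [/\ forall x y y', `|coef_f D t x y' - coef_f D t x y| <= K * enorm (y' - y),
        forall x, `|coef_f D t x 0| + `|coef_h D t x 0| + enorm (coef_fbar D t x)
                  <= K * (1 + enorm x `^ r) &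
        forall x w w', `|coef_h D t x w - coef_h D t x w'| <= K * `|w - w'| ]]) /\
  {within @strip3 R, continuous (fun z => coef_h D z.1.1 z.1.2 z.2 : R)} /\
  C1_on `[- T, T] (coef_phi D).

End DataConditions.

Section Processes.
Context (disp : measure_display) (Om : measurableType disp) (R : realType)
  (P : probability Om R) (T : R) (d m : nat).

Definition sigma_rv (U : topologicalType) (X : Om -> U) : set (set Om) :=
  preimage_set_system setT X (@borel U).

Definition past (W : R -> Om -> 'cV[R]_m) (t : R) : set (set Om) :=
  <<s \bigcup_(u in `[0, t]) sigma_rv (W u) >>.

Record is_brownian (W : R -> Om -> 'cV[R]_m) : Prop := IsBrownian {
  bm_measurable : forall t : R, 0 <= t <= T ->
    measurable_wrt measurable setT (W t);
  bm_start : {ae P, forall w, W 0 w = 0};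
  bm_continuous : {ae P, forall w, {within `[0, T], continuous (W^~ w)}};
  bm_indep : forall s t : R, 0 <= s -> s <= t -> t <= T ->
    independent P (past W s) (sigma_rv (fun w => W t w - W s w : 'cV[R]_m));
  bm_gauss : forall s t : R, 0 <= s -> s < t -> t <= T ->
    forall B : 'I_m -> set R, (forall i, measurable (B i)) ->
    P [set w | forall i, B i ((W t w - W s w) i ord0)]
      = (\prod_(i < m) normal_prob 0%R (Num.sqrt (t - s)%R) (B i))%E
}.

Context (X0 : Om -> 'cV[R]_d) (W : R -> Om -> 'cV[R]_m).

Definition filtration (t : R) : set (set Om) :=
  <<s sigma_rv X0 `|` \bigcup_(u in `[0, t]) sigma_rv (W u)
      `|` [set N | P.-negligible N] >>.

Definition adapted (U : topologicalType) (Y : R -> Om -> U) : Prop :=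
  forall t : R, 0 <= t <= T -> measurable_wrt (filtration t) setT (Y t).

Definition progressive (U : topologicalType) (Z : R -> Om -> U) : Prop :=
  forall t : R, 0 <= t <= T ->
    measurable_wrt
      <<s [set A `*` F | A in @borel R & F in filtration t] >>
      [set z | 0 <= z.1 <= t] (fun z => Z z.1 z.2).

Definition continuous_paths (U : topologicalType) (Y : R -> Om -> U) : Prop :=
  forall w, {within `[0, T], continuous (Y^~ w)}.

Definition sup_sq (U : Type) (nrm : U -> R) (y : R -> U) : \bar R :=
  ereal_sup [set ((nrm (y t)) ^+ 2)%:E | t in `[0, T]].

Definition in_S2 (U : topologicalType) (nrm : U -> R) (Y : R -> Om -> U) :
    Prop :=
  [/\ adapted Y, continuous_paths Y &
      (\int[P]_w sup_sq nrm (Y^~ w) < +oo)%E].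

Definition H2_sq (a c : nat) (Z : R -> Om -> 'M[R]_(a, c)) : \bar R :=
  (\int[P]_w \int[lebesgue_measure]_(t in `[0%R, T])
     ((enorm (Z t w)) ^+ 2)%:E)%E.

Definition in_H2 (a c : nat) (Z : R -> Om -> 'M[R]_(a, c)) : Prop :=
  progressive Z /\ (H2_sq Z < +oo)%E.

Definition in_A2 (A : R -> Om -> R) : Prop :=
  [/\ in_S2 (fun y : R => `|y|) A,
      forall w (s t : R), 0 <= s -> s <= t -> t <= T -> A s w <= A t w &
      forall w, A 0 w = 0].

(* The representatives used for the elements of V. They are progressively
   measurable and bounded, so membership in H^2 is automatic. *)
Definition in_V (L : R -> Om -> R) : Prop :=
  [/\ forall w (t : R), 0 <= t <= T -> 0 <= L t w <= 1,
      adapted L &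
      forall w (s t : R), 0 <= s -> s <= t -> t <= T -> L t w <= L s w] /\
  [/\ forall w (t : R), 0 <= t -> t < T -> L s w @[s --> t^'+] --> L t w,
      forall w (t : R), 0 < t -> t <= T -> cvg (L s w @[s --> t^'-]) &
      forall w, L T w = 0].

(* The integrand [H i] on ]tt i, tt i.+1], for i < N. *)
Record simple_process (a : nat) := SimpleProcess {
  sp_N : nat;
  sp_t : nat -> R;
  sp_H : nat -> Om -> 'M[R]_(a, m);
  sp_range : forall i, 0 <= sp_t i <= T;
  sp_mono : forall i, sp_t i <= sp_t i.+1;
  sp_meas : forall i, measurable_wrt (filtration (sp_t i)) setT (sp_H i);
  sp_bounded : exists C : R, forall i w, enorm (sp_H i w) <= C
}.

Definition simple_val (a : nat) (S : simple_process a) (s : R) (w : Om) :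
    'M[R]_(a, m) :=
  \sum_(i < sp_N S)
    (if sp_t S i < s <= sp_t S i.+1 then sp_H S i w else 0).

Definition simple_int (a : nat) (S : simple_process a) (t : R) (w : Om) :
    'cV[R]_a :=
  \sum_(i < sp_N S)
    sp_H S i w *m
      (W (Num.min (sp_t S i.+1) t) w - W (Num.min (sp_t S i) t) w).

(* [M] is (a continuous version of) the Ito integral process of [Z] against
   [W]: the limit of the integrals of simple processes converging to [Z] in
   H^2, which determines [M] up to indistinguishability. *)
Definition is_ito_integral (a : nat) (Z : R -> Om -> 'M[R]_(a, m))
    (M : R -> Om -> 'cV[R]_a) : Prop :=
  [/\ in_H2 Z, in_S2 (@enorm R a 1) M &
    exists S : nat -> simple_process a,
      (H2_sq (fun s w => simple_val (S n) s w - Z s w)%R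
         @[n --> \oo] --> 0%E) /\
      ((\int[P]_w sup_sq (@enorm R a 1)
           (fun t => simple_int (S n) t w - M t w)%R)%E
         @[n --> \oo] --> 0%E)].

Context (k : nat) (D : data R d k m).

(* E[g(s, X_s) L_s] *)
Definition mean_term (g : R -> 'cV[R]_d -> 'cV[R]_k) (X : R -> Om -> 'cV[R]_d)
    (L : R -> Om -> R) (s : R) : 'cV[R]_k :=
  \col_j fine ('E_P[fun w => (g s (X s w) j ord0 * L s w)%R]).

Definition forward_solution (L : R -> Om -> R) (X : R -> Om -> 'cV[R]_d) :
    Prop :=
  in_S2 (@enorm R d 1) X /\
  exists M, is_ito_integral
      (fun s w => coef_sigma D s (X s w) (mean_term (coef_sigmabar D) X L s)) M /\
    {ae P, forall w, forall t : R, 0 <= t <= T ->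
      X t w = X0 w
        + \col_i (\int[lebesgue_measure]_(s in `[0, t])
             (coef_b D s (X s w) (mean_term (coef_bbar D) X L s) i ord0))
        + M t w}.

Definition obstacle (L : R -> Om -> R) (X : R -> Om -> 'cV[R]_d) (t : R)
    (w : Om) : R :=
  coef_h D t (X t w)
    (fine ('E_P[fun w' => fine (decr_int T (fun s => coef_phi D (t - s)) (L^~ w'))])).

Definition rbsde_solution (L : R -> Om -> R) (X : R -> Om -> 'cV[R]_d)
    (Y : R -> Om -> R) (Z : R -> Om -> 'M[R]_(1, m)) (A : R -> Om -> R) :
    Prop :=
  let xi := obstacle L X in
  [/\ in_S2 (fun y : R => `|y|) Y, in_H2 Z & in_A2 A] /\
  [/\ exists M, is_ito_integral Z M /\
        {ae P, forall w, forall t : R, 0 <= t <= T ->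
          Y t w = xi T w
            + \int[lebesgue_measure]_(s in `[t, T])
                (coef_f D s (X s w) (mean_term (coef_fbar D) X L s))
            + A T w - A t w - (M T w - M t w) ord0 ord0},
      {ae P, forall w, forall t : R, 0 <= t <= T -> xi t w <= Y t w} &
      {ae P, forall w,
        incr_int T 0 (A^~ w) (fun t => Y t w - xi t w) = 0%E}].

End Processes.

Definition tau_min (R : realType) (Om : Type) (T : R) (Y xi : R -> Om -> R)
    (w : Om) : R :=
  inf_or T [set t | 0 <= t <= T /\ Y t w = xi t w].

Definition tau_max (R : realType) (Om : Type) (T : R) (A : R -> Om -> R)
    (w : Om) : R :=
  inf_or T [set t | 0 <= t <= T /\ 0 < A t w].

(* The process 1_{t < tau}. *)
Definition before (R : realType) (Om : Type) (tau : Om -> R) (t : R)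
    (w : Om) : R := if t < tau w then 1 else 0.

(* Main.v *)
Require Import Defs.
From mathcomp Require Import all_boot all_order all_algebra.
From mathcomp Require Import all_classical all_reals all_analysis.
From mathcomp Require Import measurable_realfun lra.

(* The argument is pathwise. The measure mu = -dL on [0, T] satisfies
   mu(]a, b]) = L_a - L_b and mu([0, b]) = 1 - L_b, and the two conditions on L
   say that mu charges neither {Y > xi} nor {A > 0}. The first set contains
   [0, t] for t < tau_min, whence L_t = 1; the second contains ]t, T] for
   t >= tau_max by monotonicity of A, whence L_t = L_T = 0. That a nonnegative
   function with zero integral vanishes almost everywhere needs measurable
   paths, so one also has to check that the obstacle xi is continuous in time,
   i.e. that t |-> E[int phi(t - s) dL_s] is: phi is uniformly continuous and
   mu has mass at most 1 for every outcome. *)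

Import Order.TTheory GRing.Theory Num.Theory.
Import numFieldNormedType.Exports.

Local Open Scope classical_set_scope.
Local Open Scope ring_scope.

(** * Stieltjes measures of extended paths *)

Lemma ext_path_cumulative (R : realType) (T v : R) (g : R -> R) :
  0 < T -> v <= g 0 ->
  (forall s t, 0 <= s -> s <= t -> t <= T -> g s <= g t) ->
  (forall t, 0 <= t -> t < T -> g s @[s --> t^'+] --> g t) ->
  is_cumulative (ext_path T v g).
Proof.
move=> T0 vg0 gmono grc; split=> [s t st|t]; rewrite /ext_path.
- case: (ltP s 0) => s0; case: (ltP t 0) => t0 //.
  + apply: (le_trans vg0); apply: gmono => //.
    * by rewrite le_min t0 ltW.
    * by rewrite ge_min lexx orbT.
  + by have := le_lt_trans (le_trans s0 st) t0; rewrite ltxx.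
  + apply: gmono.
    * by rewrite le_min s0 ltW.
    * by rewrite le_min !ge_min st lexx orbT.
    * by rewrite ge_min lexx orbT.
- case: (ltP t 0) => t0.
    apply: cvg_near_cst; near=> s.
    by have -> : s < 0 by near: s; exact: nbhs_right_lt.
  have [tT|Tt] := ltP t T.
    apply: cvg_trans (grc _ t0 tT); apply: near_eq_cvg; near=> s.
    have ts : t < s by near: s; exact: nbhs_right_gt.
    have sT : s < T by near: s; exact: nbhs_right_lt.
    by rewrite ltNge (le_trans t0 (ltW ts))/= min_l// ltW.
  apply: cvg_near_cst; near=> s.
  have ts : t < s by near: s; exact: nbhs_right_gt.
  by rewrite ltNge (le_trans t0 (ltW ts))/= min_r// (le_trans Tt)// ltW.
Unshelve. all: by end_near. Qed.

Lemma as_cumulativeE (R : realType) (F : R -> R) :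
  is_cumulative F -> as_cumulative F = F :> (R -> R).
Proof. by move=> HF; rewrite /as_cumulative; case: pselect. Qed.

Lemma lebesgue_stieltjes_oc (R : realType) (F : cumulative R R) (a b : R) :
  a <= b -> lebesgue_stieltjes_measure F `]a, b] = (F b - F a)%:E.
Proof.
move=> ab; rewrite /lebesgue_stieltjes_measure/= /measure_extension.
rewrite measurable_mu_extE; last exact: is_ocitv.
exact: wlength_itv_bnd.
Qed.


(** The extended path is constant before 0, so every []a, - n.+1%:R^-1]] is null, and these exhaust
    the interval. Their right ends stay below 0 because []a, 0]] would already contain the jump at
    0. *)
Lemma lebesgue_stieltjes_ext_path_lt0 (R : realType) (T v a : R) (g : R -> R) :
  is_cumulative (ext_path T v g) ->
  (lebesgue_stieltjes_measure (as_cumulative (ext_path T v g))).-negligible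
    `]a, 0[.
Proof.
move=> cg.
have -> : `]a, 0[%classic = \bigcup_n `]a, - n.+1%:R^-1]%classic :> set R.
  apply/seteqP; split=> [x|x [n _]] /=; rewrite !in_itv/= => /andP[ax x0].
    exists (Num.truncn (- x)^-1) => //=; rewrite in_itv/= ax/= lerNr -[leRHS]invrK.
    by rewrite lef_pV2 ?posrE ?invr_gt0 ?oppr_gt0// ltW// truncnS_gt.
  by rewrite ax (le_lt_trans x0)// oppr_lt0 invr_gt0.
apply: negligible_bigcup => n; apply/negligibleP; first exact: measurable_itv.
have [an|an] := leP a (- n.+1%:R^-1).
  have n0 : - n.+1%:R^-1 < 0 :> R by rewrite oppr_lt0 invr_gt0.
  rewrite [LHS]lebesgue_stieltjes_oc// as_cumulativeE// /ext_path n0.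
  by rewrite (le_lt_trans an n0) subrr.
by rewrite set_itv_ge ?measure0// bnd_simp -leNgt ltW.
Qed.

(** * Integrals of possibly non-measurable functions *)

(* Without measurability the integral of a nonnegative function is its lower
   integral, which is still monotone. *)
Lemma lower_integral_le d (T : measurableType d) (R : realType)
    (mu : {measure set T -> \bar R}) (f g : T -> \bar R) :
  (forall x, 0 <= f x)%E -> (forall x, f x <= g x)%E ->
  (\int[mu]_x f x <= \int[mu]_x g x)%E.
Proof.
move=> f0 fg; rewrite !ge0_integralTE//; last by move=> x; exact: le_trans (fg x).
apply: ge_ereal_sup => _ [h hf <-]; apply: ereal_sup_ubound; exists h => //= x.
exact: le_trans (hf x) (fg x).
Qed.

Import HBNNSimple.

(** If a simple [h] lies below [f + e], then [max(h - e, 0)] is measurable, lies below [f], and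
    dominates [h] after adding [e]; the constant integrates to [e] because [P] has mass 1. *)
Lemma lower_integralD_cst d (T : measurableType d) (R : realType)
    (P : probability T R) (f : T -> R) (e : R) : 0 <= e -> (forall x, 0 <= f x) ->
  (\int[P]_x (f x + e)%:E <= \int[P]_x (f x)%:E + e%:E)%E.
Proof.
move=> e0 f0; rewrite ge0_integralTE; last by move=> x; rewrite lee_fin addr_ge0.
apply: ge_ereal_sup => _ [h hf <-].
pose k x := Num.max (h x - e) 0.
have mk : measurable_fun setT k.
  by apply: measurable_maxr => //; apply: measurable_funB.
have k0 x : (0 <= (k x)%:E)%E by rewrite lee_fin /k le_max lexx orbT.
have -> : sintegral P h = (\int[P]_x (h x)%:E)%E.
  by rewrite integral_nnsfun// patch_setT.
apply: (@le_trans _ _ (\int[P]_x ((k x)%:E + e%:E))%E).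
  apply: ge0_le_integral => //.
  - by move=> x _; rewrite lee_fin; exact: fun_ge0.
  - exact/measurable_EFinP.
  - by apply: emeasurable_funD; exact/measurable_EFinP.
  - by move=> x _; rewrite -EFinD lee_fin -lerBlDr /k le_max lexx.
rewrite ge0_integralD//; last exact/measurable_EFinP.
rewrite integral_cst// [X in (_ * X)%E]probability_setT mule1 leeD2r//.
apply: lower_integral_le => // x; rewrite lee_fin /k ge_max f0 andbT lerBlDr.
by rewrite -lee_fin.
Qed.

(* [f] and [g] need not be measurable, and then their positive and negative
   parts are compared separately: hence the factor 2. This avoids proving that
   the pathwise Stieltjes integrals depend measurably on the outcome. *)
Lemma expectation_bounded_dist d (T : measurableType d) (R : realType)
    (P : probability T R) (f g : T -> R) (M e : R) :
  (forall x, `|f x| <= M) -> (forall x, `|g x| <= M) ->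
  (forall x, `|f x - g x| <= e) ->
  `|fine 'E_P[f] - fine 'E_P[g]| <= 2 * e.
Proof.
move=> fM gM fge.
(* Measurable types are pointed, so the bounds can be evaluated at [point]. *)
have M0 : 0 <= M by exact: le_trans (normr_ge0 _) (fM point).
have e0 : 0 <= e by exact: le_trans (normr_ge0 _) (fge point).
pose I (u : T -> R) := (\int[P]_x (u x)%:E)%E.
have I_ge0 u : (forall x, 0 <= u x) -> (0 <= I u)%E.
  by move=> u0; apply: integral_ge0 => x _; rewrite lee_fin.
(* Finiteness matters: [fine] sends infinite values to 0. *)
have I_fin u : (forall x, 0 <= u x <= M) -> I u \is a fin_num.
  move=> uM; rewrite ge0_fin_numE; last by apply: I_ge0 => x; case/andP: (uM x).
  apply: (@le_lt_trans _ _ (\int[P]_x M%:E)%E).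
    by apply: lower_integral_le => x; rewrite lee_fin; case/andP: (uM x).
  by rewrite integral_cst// [X in (_ * X)%E]probability_setT mule1 ltry.
have I_dist u v : (forall x, 0 <= u x <= M) -> (forall x, 0 <= v x <= M) ->
    (forall x, u x <= v x + e) -> fine (I u) <= fine (I v) + e.
  move=> uM vM uv; rewrite -lee_fin EFinD !fineK ?I_fin//.
  apply: le_trans (lower_integralD_cst d T R P v e e0 _); last first.
    by move=> x; case/andP: (vM x).
  by apply: lower_integral_le => x; rewrite lee_fin//; case/andP: (uM x).
pose pos (u : T -> R) x := Num.max (u x) 0.
have posM u : (forall x, `|u x| <= M) -> forall x, 0 <= pos u x <= M.
  move=> uM x; rewrite /pos le_max lexx orbT ge_max M0 andbT.
  exact: le_trans (ler_norm _) (uM x).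
have normN (u : T -> R) : (forall x, `|u x| <= M) -> forall x, `|(- u x)| <= M.
  by move=> uM x; rewrite normrN.
have EI u : (forall x, `|u x| <= M) ->
    fine 'E_P[u] = fine (I (pos u)) - fine (I (pos (fun x => - u x))).
  move=> uM; rewrite unlock integralE -fineB; last 2 first.
  - exact/I_fin/posM.
  - exact/I_fin/posM/normN.
  congr (fine (_ - _)); apply: eq_integral => x _.
  - by rewrite funeposE EFin_max.
  - by rewrite funenegE EFin_max.
have pos_dist (u v : T -> R) : (forall x, `|u x| <= M) ->
    (forall x, `|v x| <= M) -> (forall x, u x <= v x + e) ->
    fine (I (pos u)) <= fine (I (pos v)) + e.
  move=> uM vM uv; apply: I_dist; [exact: posM|exact: posM|move=> x].
  rewrite /pos ge_max (le_trans (uv x)) ?lerD2r ?le_max ?lexx//=.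
  by rewrite addr_ge0// le_max lexx orbT.
have fgx x : - e <= f x - g x <= e by rewrite -ler_norml.
(* [H1] and [H2] bring the positive parts within [e] of each other, [H3] and [H4] the negative
   parts; the two errors add up to [2 * e]. *)
have H1 := pos_dist f g fM gM ltac:(by move=> x; move: (fgx x); lra).
have H2 := pos_dist g f gM fM ltac:(by move=> x; move: (fgx x); lra).
have H3 := pos_dist _ _ (normN f fM) (normN g gM)
  ltac:(by move=> x; move: (fgx x); lra).
have H4 := pos_dist _ _ (normN g gM) (normN f fM)
  ltac:(by move=> x; move: (fgx x); lra).
by rewrite !EI// ler_norml; apply/andP; split; lra.
Qed.

(** * The measure of a single decreasing path *)

Definition decr_path (R : realType) (T : R) (l : R -> R) : Prop :=
  [/\ forall t, 0 <= t <= T -> 0 <= l t <= 1,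
      forall s t, 0 <= s -> s <= t -> t <= T -> l t <= l s,
      forall t, 0 <= t -> t < T -> l s @[s --> t^'+] --> l t &
      l T = 0].

Section DecreasingPath.
Context (R : realType) (T : R) (T_gt0 : 0 < T) (l : R -> R).
Hypothesis l_path : decr_path R T l.

Let nl := ext_path T (- 1) (fun t => - l t).
Let mu := lebesgue_stieltjes_measure (as_cumulative nl).

Let nl_cumulative : is_cumulative nl.
Proof.
case: l_path => l01 lmono lrc _; apply: ext_path_cumulative => //.
- by rewrite lerN2; have /andP[] := l01 0 ltac:(by rewrite lexx ltW).
- by move=> s t s0 st tT; rewrite lerN2 lmono.
- by move=> t t0 tT; apply: cvgN; exact: lrc.
Qed.

Lemma decr_path_oc (a b : R) : 0 <= a -> a <= b -> b <= T ->
  mu `]a, b] = (l a - l b)%:E.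
Proof.
move=> a0 ab bT; rewrite /mu [LHS]lebesgue_stieltjes_oc// as_cumulativeE//.
rewrite /nl /ext_path ltNge (le_trans a0 ab) ltNge a0/=.
by rewrite !min_l// ?(le_trans ab)// opprK addrC.
Qed.

(** The left endpoint is just some time before 0: starting there includes the jump of [- l] at time
    0, from its value -1 at 0-. *)
Let mu_oc0 (b : R) : 0 <= b -> b <= T -> mu `](- 1), b] = (1 - l b)%:E.
Proof.
move=> b0 bT; rewrite /mu [LHS]lebesgue_stieltjes_oc ?as_cumulativeE//; last first.
  by apply: le_trans b0; rewrite lerN10.
by rewrite /nl /ext_path ltNge b0/= ltrN10 min_l// opprK addrC.
Qed.

Lemma decr_path_mass_le1 : (mu `[0%R, T] <= 1)%E.
Proof.
have -> : 1%E = mu `](- 1), T].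
  by rewrite mu_oc0 ?(ltW T_gt0)//; case: l_path => _ _ _ ->; rewrite subr0.
apply: le_measure; rewrite ?inE; try exact: measurable_itv.
by apply: subset_itvr; rewrite bnd_simp ltrN10.
Qed.

(** Nothing is charged before time 0, so []-1, b]], of mass [1 - l b], is null as soon as [[0, b]]
    is. *)
Lemma decr_path_null (b : R) : 0 <= b -> b <= T ->
  mu.-negligible `[0, b] -> l b = 1.
Proof.
move=> b0 bT mu0; suff : mu `](- 1), b] = 0%E.
  by rewrite mu_oc0// => -[]; lra.
apply/negligibleP; first exact: measurable_itv.
have : mu.-negligible (`](- 1), 0[ `|` `[0, b]).
  by apply: negligibleU mu0; exact: lebesgue_stieltjes_ext_path_lt0.
apply: negligibleS => x /=; rewrite !in_itv/= => /andP[-> ->].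
by rewrite andbT; case: (ltP x 0) => _; [left|right].
Qed.

Lemma decr_int_eq0 (F : R -> R) : {within `[0, T], continuous F} ->
  (forall t, 0 <= t <= T -> 0 <= F t) -> decr_int T F l = 0%E ->
  mu.-negligible [set t | 0 <= t <= T /\ 0 < F t].
Proof.
move=> cF F0; rewrite /decr_int => /eqP; rewrite oppe_eq0 => /eqP.
rewrite /incr_int -/nl -/mu => I0.
have mF : measurable_fun `[0, T] (EFin \o F).
  apply/measurable_EFinP; apply: subspace_continuous_measurable_fun.
  - exact: measurable_itv.
  - exact: cF.
have /(ae_eq_integral_abs mu (measurable_itv _) mF).1 :
    (\int[mu]_(x in `[0%R, T]) `|(EFin \o F) x| = 0)%E.
  rewrite -[RHS]I0; apply: eq_integral => t /=.
  by rewrite inE/= in_itv/= => /F0 Ft; rewrite ger0_norm.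
apply: negligibleS => t [tT Ft] /=; rewrite in_itv/= => /(_ tT)[].
by move=> Ft0; rewrite Ft0 ltxx in Ft.
Qed.

(** The mass of [mu] on [[0, T]] is at most 1, so a uniform bound on [F - G] passes to the
    integrals; both are finite since continuous functions are bounded on a segment. *)
Lemma decr_int_dist (F G : R -> R) (e : R) :
  {within `[0, T], continuous F} -> {within `[0, T], continuous G} ->
  (forall t, 0 <= t <= T -> `|F t - G t| <= e) ->
  `|fine (decr_int T F l) - fine (decr_int T G l)| <= e.
Proof.
move=> cF cG FGe.
have intF H : {within `[0, T], continuous H} ->
    mu.-integrable `[0, T] (EFin \o H).
  move=> cH; apply: measurable_bounded_integrable.
  - exact: measurable_itv.
  - exact: le_lt_trans decr_path_mass_le1 (ltry _).
  - exact: subspace_continuous_measurable_fun.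
  - have := continuous_compact cH (@segment_compact _ _ _).
    by move=> /compact_bounded[M [Mr HM]]; exists M; split=> // x /HM Hx y yT;
      apply: Hx; exists y.
have e0 : 0 <= e by apply: le_trans (normr_ge0 _) (FGe 0 _); rewrite lexx ltW.
rewrite /decr_int /incr_int -/nl -/mu !fineN -opprD normrN -RintegralB; last 3 first.
- exact: measurable_itv.
- exact: intF.
- exact: intF.
have iFG : mu.-integrable `[0, T] (EFin \o (fun t => F t - G t)).
  by apply: (@integrableB _ _ _ mu _ _ (EFin \o F) (EFin \o G)) => //; exact: intF.
rewrite -lee_fin.
have -> : `|\int[mu]_(x in `[0, T]) (F x - G x)|%:E =
    `| \int[mu]_(x in `[0%R, T]) (F x - G x)%:E |%E.
  by rewrite /Rintegral -abse_EFin fineK// integrable_fin_num.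
apply: le_trans (le_abse_integral _ _ _) _ => //; first by case/integrableP: iFG.
apply: (@le_trans _ _ (e%:E * mu `[0%R, T])%E).
  apply: integral_le_bound => //; first by case/integrableP: iFG.
  by apply: aeW => t; rewrite /= in_itv/= lee_fin => /FGe.
by rewrite -[leRHS]mule1 lee_wpmul2l// decr_path_mass_le1.
Qed.

End DecreasingPath.

(** * Continuity of the obstacle in time *)

Lemma C1_on_continuous (R : realType) (A : set R) (g : R -> R) :
  C1_on A g -> {within A, continuous g}.
Proof.
move=> [g' [_ dg]]; apply/subspace_continuousP => t At.
have gt : g s @[s --> within A t^'] --> g t.
  have st0 : (s - t) @[s --> within A t^'] --> (0 : R).
    rewrite -(subrr t); apply: cvgB; last exact: cvg_cst.
    by do 2 apply: cvg_within_filter; exact: cvg_id.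
  (* Away from [t] this expression equals [g s], and its difference quotient converges. *)
  have : g t + (s - t) * ((s - t)^-1 * (g s - g t)) @[s --> within A t^']
      --> g t + 0 * g' t.
    by apply: cvgD; [exact: cvg_cst|exact: (cvgM st0 (dg t At))].
  rewrite mul0r addr0 => /(cvg_trans _); apply; apply: near_eq_cvg.
  rewrite near_withinE near_withinE; near=> s => st As.
  by rewrite mulVKf ?subr_eq0//= addrC subrK.
(* The limit above is over a punctured neighbourhood; the point [t] itself is added by hand. *)
move=> U gU; have gt' : \forall s \near t, s != t -> A s -> U (g s) := gt U gU.
suff : \forall s \near t, A s -> U (g s) by [].
apply: filterS gt' => s; have [-> _ _|st +] := eqVneq s t; last exact.
exact: nbhs_singleton.
Unshelve. all: by end_near. Qed.

Section Convolution.
Context (R : realType) (T : R) (phi : R -> R).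
Hypothesis cphi : {within `[- T, T], continuous phi}.

Lemma convolution_within_continuous (t : R) : 0 <= t <= T ->
  {within `[0, T], continuous (fun s => phi (t - s))}.
Proof.
move=> tT; apply/subspace_continuousP => s; rewrite /= in_itv/= => sT.
move/subspace_continuousP: cphi => /(_ (t - s)); rewrite /= in_itv/=.
move=> /(_ ltac:(by apply/andP; split; lra)); apply: cvg_comp.
move=> U HU.
have ts : (t - s') @[s' --> s] --> t - s.
  by apply: cvgB; [exact: cvg_cst|exact: cvg_id].
suff : \forall s' \near s, `[0, T]%classic s' -> U (t - s') by [].
have HU' : \forall s' \near s, `[- T, T]%classic (t - s') -> U (t - s') := ts _ HU.
apply: filterS HU' => s' + s'T; apply.
by move: s'T; rewrite /= !in_itv/= => s'T; apply/andP; split; lra.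
Qed.

(** Near each [s0], both [t - s] and [t0 - s] are close to [t0 - s0], where [phi] is continuous;
    compactness of [[0, T]] makes the neighbourhood of [t0] uniform in [s]. *)
Lemma convolution_equicontinuous (t0 e : R) : 0 <= t0 <= T -> 0 < e ->
  \forall t \near within `[0, T] (nbhs t0), forall s, 0 <= s <= T ->
    `|phi (t - s) - phi (t0 - s)| <= e.
Proof.
move=> t0T e0.
have /compact_near_coveringP/near_covering_withinP := @segment_compact R 0 T.
move=> /(_ _ (within `[0, T] (nbhs t0))
  (fun t s => `|phi (t - s) - phi (t0 - s)| <= e) _) H.
have : \forall t \near within `[0, T] (nbhs t0),
    `[0, T]%classic `<=` (fun s => `|phi (t - s) - phi (t0 - s)| <= e).
  apply: H => s0; rewrite /= in_itv/= => s0T.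
  move/subspace_continuousP: cphi => /(_ (t0 - s0)); rewrite /= in_itv/=.
  move=> /(_ ltac:(by apply/andP; split; lra)) /cvgrPdist_le/(_ (e / 2)).
  rewrite divr_gt0// => /(_ isT); rewrite near_withinE => /nbhs_ballP[r /= r0 Hr].
  (* Halving [r] leaves room for moving both [t] and [s]; halving [e] leaves room for the triangle
     inequality through [phi (t0 - s0)]. *)
  have Hp (t s : R) : `|t - t0| < r / 2 -> `|s - s0| < r / 2 ->
      0 <= t <= T -> 0 <= s <= T -> `|phi (t0 - s0) - phi (t - s)| <= e / 2.
    move=> tr sr tT sT; apply: Hr.
      rewrite /ball/= (_ : _ - _ = (s - s0) - (t - t0)); last by lra.
      by rewrite (le_lt_trans (ler_normB _ _))//; lra.
    by rewrite /= in_itv/=; apply/andP; split; lra.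
  exists (ball s0 (r / 2), [set t | `|t - t0| < r / 2 /\ 0 <= t <= T]).
    split => /=; first by apply: nbhsx_ballx; rewrite divr_gt0.
    suff : \forall t \near t0, `[0, T]%classic t ->
      `|t - t0| < r / 2 /\ 0 <= t <= T by [].
    have : nbhs t0 (ball t0 (r / 2)).
      by apply: nbhsx_ballx; rewrite divr_gt0.
    apply: filterS => t; rewrite /ball/= distrC => tr.
    by rewrite in_itv/=.
  move=> [s t] /= [sr [tr tT]]; rewrite in_itv/= => sT.
  move: sr; rewrite /ball/= distrC => sr.
  have := Hp t s tr sr tT sT.
  have := Hp t0 s ltac:(by rewrite subrr normr0 divr_gt0) sr t0T sT.
  rewrite !ler_norml => /andP[? ?] /andP[? ?]; apply/andP; split; lra.
by apply: filterS => t tP s sT; apply: tP; rewrite /= in_itv.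
Qed.

End Convolution.

Section Obstacle.
Context (disp : measure_display) (Om : measurableType disp) (R : realType)
  (P : probability Om R) (T : R) (d k m : nat) (D : data R d k m).
Hypothesis T_gt0 : 0 < T.

Lemma mean_convolution_continuous (phi : R -> R) (L : R -> Om -> R) :
  {within `[- T, T], continuous phi} -> (forall w, decr_path R T (L^~ w)) ->
  {within `[0, T], continuous (fun t =>
    fine 'E_P[fun w => fine (decr_int T (fun s => phi (t - s)) (L^~ w))])}.
Proof.
move=> cphi Lp; apply/subspace_continuousP => t0; rewrite /= in_itv/= => t0T.
have [M [Mr HM]] : bounded_set (phi @` `[- T, T]).
  exact/compact_bounded/continuous_compact/segment_compact.
(* [bounded_set] provides a bound for each number strictly above [M], hence the added 1. *)
pose B := `|M| + 1.
have phiB t s : 0 <= t <= T -> 0 <= s <= T -> `|phi (t - s)| <= B.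
  move=> tT sT; apply: HM.
    by rewrite /B (le_lt_trans (ler_norm _))// ltrDl.
  by exists (t - s) => //; rewrite /= in_itv/=; apply/andP; split; lra.
have c0 : {within `[0, T], continuous (cst (0 : R))}.
  by apply: continuous_subspaceT => x; exact: cvg_cst.
have dB t w : 0 <= t <= T ->
    `|fine (decr_int T (fun s => phi (t - s)) (L^~ w))| <= B.
  move=> tT.
  (* Comparison with the zero function turns the distance estimate into a bound uniform in the
     outcome. *)
  have := decr_int_dist R T T_gt0 _ (Lp w) (fun s => phi (t - s)) (cst 0) B.
  rewrite {2}/decr_int/incr_int/= integral0 oppe0 subr0; apply => //.
    exact: convolution_within_continuous.
  by move=> s sT; rewrite subr0; exact: phiB.
apply/cvgrPdist_le => e e0.
have := convolution_equicontinuous R T phi cphi t0 (e / 2) t0T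
  ltac:(by rewrite divr_gt0).
rewrite !near_withinE; apply: filterS => t + tT; move=> /(_ tT) te.
move: tT; rewrite /= in_itv/= => tT.
(* The pathwise error is [e / 2]; the expectation bound costs the factor 2. *)
rewrite [leRHS](_ : e = 2 * (e / 2)); last by lra.
apply: (expectation_bounded_dist _ _ _ P _ _ B) => [w|w|w]; try exact: dB.
apply: decr_int_dist => //.
- exact: convolution_within_continuous.
- exact: convolution_within_continuous.
- by move=> s sT; rewrite distrC; exact: te.
Qed.

Lemma obstacle_continuous (q : R) (L : R -> Om -> R) (X : R -> Om -> 'cV[R]_d)
    (w : Om) :
  backward_regular T q D -> (forall w, decr_path R T (L^~ w)) ->
  {within `[0, T], continuous (X^~ w)} ->
  {within `[0, T], continuous ((obstacle P T D L X)^~ w)}.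
Proof.
move=> [_ [ch /C1_on_continuous cphi]] Lp cX.
have cc := mean_convolution_continuous _ _ cphi Lp.
apply/subspace_continuousP => t tT; rewrite /obstacle.
set c := fun t => fine 'E_P[_] in cc *.
have /= tT' := tT; rewrite in_itv/= in tT'.
move/subspace_continuousP: ch => /(_ (t, X t w, c t) tT') ch.
have cp : (s, X s w, c s) @[s --> within `[0, T] (nbhs t)] --> (t, X t w, c t).
  have ct := (subspace_continuousP _ _).1 cc t tT.
  have Xt := (subspace_continuousP _ _).1 cX t tT.
  have tt : s @[s --> within `[0, T] (nbhs t)] --> t.
    by apply: cvg_within_filter; exact: cvg_id.
  exact: (cvg_pair (cvg_pair tt Xt) ct).
(* [h] is continuous only within the strip, so the curve must converge within it too; it stays there
   because [s] lies in [[0, T]]. *)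
suff cps : (s, X s w, c s) @[s --> within `[0, T] (nbhs t)] -->
    within (@strip3 R d T R) (nbhs (t, X t w, c t)) by exact: cvg_comp cps ch.
move=> U HU; have HU' : \forall s \near t, `[0, T]%classic s ->
  @strip3 R d T R (s, X s w, c s) -> U (s, X s w, c s) := cp _ HU.
suff : \forall s \near t, `[0, T]%classic s -> U (s, X s w, c s) by [].
apply: filterS HU' => s + sT; apply => //.
Qed.

End Obstacle.

(** * Comparison with the two stopping times *)

Lemma in_V_decr_path (disp : measure_display) (Om : measurableType disp)
    (R : realType) (P : probability Om R) (T : R) (d m : nat)
    (X0 : Om -> 'cV[R]_d) (W : R -> Om -> 'cV[R]_m) (L : R -> Om -> R) (w : Om) :
  in_V P T X0 W L -> decr_path R T (L^~ w).
Proof.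
move=> [[L01 _ Lmono] [Lrc _ LT]];
  split; [exact: L01|exact: Lmono|exact: Lrc|exact: LT].
Qed.

Lemma decr_path_lt_tau_min (R : realType) (Om : Type) (T : R)
    (Y xi : R -> Om -> R) (l : R -> R) (w : Om) (t : R) :
  0 < T -> decr_path R T l ->
  {within `[0, T], continuous (fun t => Y t w - xi t w)} ->
  (forall t, 0 <= t <= T -> xi t w <= Y t w) ->
  decr_int T (fun t => Y t w - xi t w) l = 0%E ->
  0 <= t <= T -> t < tau_min T Y xi w -> l t = 1.
Proof.
move=> T0 lp cF xiY I0 /andP[t0 tT]; rewrite /tau_min /inf_or.
set S := [set _ | _] => ttau.
have F0 s : 0 <= s <= T -> 0 <= Y s w - xi s w by rewrite subr_ge0; exact: xiY.
apply: (decr_path_null R T T0 l lp) => //.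
apply: (negligibleS _ (decr_int_eq0 R T l _ cF F0 I0)) => s /=.
rewrite in_itv/= => /andP[s0 st]; have sT : 0 <= s <= T.
  by rewrite s0 (le_trans st).
split=> //; rewrite lt_neqAle F0// andbT eq_sym subr_eq0; apply/eqP => Yxi.
have Ss : S s by [].
(* A contact time [s <= t] makes [S] nonempty, so [tau_min] is a true infimum and is at most [s],
   contradicting [t < tau_min]. *)
move: ttau; case: asboolP => [_|]; last by case; exists s.
rewrite ltNge => /negP; apply; apply: le_trans st; apply: ge_inf => //.
by exists 0 => u [] /andP[].
Qed.

Lemma decr_path_ge_tau_max (R : realType) (Om : Type) (T : R)
    (A : R -> Om -> R) (l : R -> R) (w : Om) (t : R) :
  0 < T -> decr_path R T l ->
  {within `[0, T], continuous (A^~ w)} ->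
  (forall s t, 0 <= s -> s <= t -> t <= T -> A s w <= A t w) -> A 0 w = 0 ->
  decr_int T (A^~ w) l = 0%E ->
  0 <= t <= T -> tau_max T A w <= t -> l t = 0.
Proof.
move=> T0 lp cA Amono A0 I0 /andP[t0 tT]; rewrite /tau_max /inf_or.
have [_ _ _ lT] := lp.
(* If [A] is never positive, the default value [T] of [tau_max] forces [t = T], where [l]
   vanishes. *)
set S := [set _ | _]; case: asboolP => [S0|_] tau_t; last first.
  by have -> : t = T by apply/eqP; rewrite eq_le tT.
have A_ge0 s : 0 <= s <= T -> 0 <= A s w.
  by move=> /andP[s0 sT]; rewrite -A0; exact: Amono.
have : (l t - l T)%:E = 0%E; last by rewrite lT subr0 => -[].
rewrite -(decr_path_oc R T T0 l lp)//; apply/negligibleP.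
  exact: measurable_itv.
apply: (negligibleS _ (decr_int_eq0 R T l _ cA A_ge0 I0)) => s /=.
rewrite in_itv/= => /andP[ts sT]; split; first by rewrite sT (le_trans t0)// ltW.
(* [A] may vanish at [tau_max] itself, but strictly after it some earlier [u] has [A u w > 0], and
   monotonicity carries this to [s]. The interval open at [t] suffices, its mass being
   [l t - l T]. *)
have [u [/andP[u0 uT] Au] us] : exists2 u, S u & u < s.
  by apply: inf_lt => //; exact: le_lt_trans ts.
by apply: lt_le_trans Au _; apply: Amono => //; exact: ltW.
Qed.

Theorem theorem3p1
  (R : realType) (T : R) (hT : 0 < T)
  (d k m : nat) (hd : (1 <= d)%N) (hk : (1 <= k)%N) (hm : (1 <= m)%N)
  (q : R) (hq : 4 <= q)
  (disp : measure_display) (Om : measurableType disp) (P : probability Om R)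
  (hP : measure_is_complete P)
  (W : R -> Om -> 'cV[R]_m) (hW : is_brownian P T W)
  (X0 : Om -> 'cV[R]_d)
  (hX0 : measurable_wrt measurable setT X0)
  (hX0W : independent P (sigma_rv X0) (past W T))
  (hX0q : (\int[P]_w (enorm (X0 w) `^ q)%:E < +oo)%E)
  (D : data R d k m) (hD : data_measurable T D)
  (hfwd : forward_lipschitz T D) (hbwd : backward_regular T q D)
  (Lh : R -> Om -> R) (hLh : in_V P T X0 W Lh)
  (Xh : R -> Om -> 'cV[R]_d) (hXh : forward_solution P T X0 W D Lh Xh)
  (Yh : R -> Om -> R) (Zh : R -> Om -> 'M[R]_(1, m)) (Ah : R -> Om -> R)
  (hYZA : rbsde_solution P T X0 W D Lh Xh Yh Zh Ah)
  (L : R -> Om -> R) (hL : in_V P T X0 W L) :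
  let xih := obstacle P T D Lh Xh in
  let tmin := tau_min T Yh xih in
  let tmax := tau_max T Ah in
  {ae P, forall w, decr_int T (fun t => Yh t w - xih t w) (L^~ w) = 0%E} ->
  {ae P, forall w, decr_int T (Ah^~ w) (L^~ w) = 0%E} ->
  {ae P, forall w, forall t : R, 0 <= t <= T ->
    before tmin t w <= L t w <= before tmax t w} /\
  {ae P, forall w, forall t : R, 0 <= t <= T ->
    (t < tmin w -> L t w = 1) /\ (tmax w <= t -> L t w = 0)}.
Proof.
move=> xih tmin tmax hmin hmax.
have Lhp w : decr_path R T (Lh^~ w) by exact: in_V_decr_path hLh.
have Lp w : decr_path R T (L^~ w) by exact: in_V_decr_path hL.
have [[_ cXh _] _] := hXh.
have [[[_ cYh _] _ [[_ cAh _] Ahmono Ah0]] [_ hxiY _]] := hYZA.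
have cF w : {within `[0, T], continuous (fun t => Yh t w - xih t w)}.
  move=> t; apply: cvgB; first exact: cYh.
  exact: (obstacle_continuous _ _ _ P T d k m D hT q Lh Xh w hbwd Lhp (cXh w)).
(* The two-sided bound follows from the second form together with [0 <= L <= 1]. *)
suff H : {ae P, forall w, forall t : R, 0 <= t <= T ->
    (t < tmin w -> L t w = 1) /\ (tmax w <= t -> L t w = 0)}.
  split=> //; apply: filterS H => w Hw t tT; have [Hmin Hmax] := Hw t tT.
  have [L01 _ _ _] := Lp w; have /andP[L0 L1] := L01 t tT.
  rewrite /before; apply/andP; split; case: ltP => //.
  - by move=> /Hmin ->.
  - by move=> /Hmax ->.
(* The exceptional null sets come only from the two integral conditions and from [xi <= Y]; path
   regularity holds for every outcome. *)
apply: filterS3 hmin hmax hxiY => w I1 I2 xiY t tT; split.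
- exact: (decr_path_lt_tau_min R Om T Yh xih (L^~ w) w t hT (Lp w) (cF w)
    xiY I1 tT).
- exact: (decr_path_ge_tau_max R Om T Ah (L^~ w) w t hT (Lp w) (cAh w) (Ahmono w)
    (Ah0 w) I2 tT).
Qed.
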